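(* Let $(S,d)$ be a stable metric space. The following are equivalent: (i) $S$ is stable compact; (ii) for every stable sequence $(R_n)_{n\in L^0_s(\mathbb N)}$ of stable closed subsets of $S$ which is decreasing ($R_m\subset R_n$ whenever $n\le m$), one has $\bigcap_nR_n\neq\emptyset$; (iii) $S$ is stable sequentially compact; (iv) $S$ is stable totally bounded and stable complete.
   Context: $L^0$: real measurable functions on a probability space $(\Omega,\mathcal F,\mathbb P)$ modulo a.e. equality, a.e. order; $L^0_+=\{r\ge0\}$, $L^0_{++}=\{r>0\text{ a.e.}\}$. An $L^0$-module $E$ is stable if for every countable measurable partition $(A_k)$ and $(x_k)\subset E$ there is a unique $x=\sum_k1_{A_k}x_k$ with $1_{A_k}x=1_{A_k}x_k$. A nonempty subset is stable if closed under concatenations; for stable sets $Y_k$, $\sum_k1_{A_k}Y_k=\{\sum_k1_{A_k}y_k:y_k\in Y_k\}$, and $\mathrm{st}(X)$ is the set of all concatenations of elements of $X$. A subset $N$ of a stable set $S$ is stable finite if $N=\sum_k1_{A_k}\mathrm{st}(X_k)$ for some countable partition $(A_k)$ and finite nonempty $X_k\subset S$. $L^0_s(\mathbb N)$ is the set of $n=\sum_k1_{A_k}n_k$, $n_k\in\mathbb N$ (concatenation pointwise, a.e. order). A map $f$ between stable sets is stable if $f(\sum_k1_{A_k}x_k)=\sum_k1_{A_k}f(x_k)$. A stable metric on a stable subset $S$ of a stable $L^0$-module is a stable map $d:S\times S\to L^0_+$ with $d(x,y)=0\iff x=y$, symmetry and the triangle inequality; the topology has base $B_r(x)=\{y:d(x,y)<r\}$,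 $x\in S$, $r\in L^0_{++}$. A stable sequence is a family $(x_n)_{n\in L^0_s(\mathbb N)}$ with $n\mapsto x_n$ stable (analogously for a stable sequence of stable sets: $R_{\sum1_{A_k}n_k}=\sum_k1_{A_k}R_{n_k}$). It converges to $x$ if for every $r\in L^0_{++}$ there is $n_0\in L^0_s(\mathbb N)$ with $d(x_n,x)<r$ for all $n\ge n_0$; it is Cauchy if for every $r\in L^0_{++}$ there is $n_0$ with $d(x_n,x_m)\le r$ for $n,m\ge n_0$. A stable subsequence is $(x_{n_k})_{k\in L^0_s(\mathbb N)}$ with $k\mapsto n_k$ stable and increasing. $S$ is stable complete if every Cauchy stable sequence converges; stable sequentially compact if every stable sequence has a stable subsequence converging in $S$; stable totally bounded if for every $r\in L^0_{++}$ there is a stable finite $N\subset S$ with $S=\bigcup_{x\in N}B_r(x)$. A filter on $S$ is stable if it has a filter base which is a stable collection of stable sets; $S$ is stable compact if every stable filter has a cluster point in $S$. *)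

(* Defs.v *)
From HB Require Import structures.
From mathcomp Require Import all_boot all_order all_algebra.
From mathcomp Require Import all_classical all_reals all_analysis.
Set Implicit Arguments. Unset Strict Implicit. Unset Printing Implicit Defensive.
Import Order.TTheory GRing.Theory Num.Theory.
Local Open Scope classical_set_scope.
Local Open Scope ring_scope.

(* L^0 is represented by measurable functions T -> R; equality/order in L^0
   are taken almost surely (P-a.e.). *)
Section StableL0.
Context {d : measure_display} {T : measurableType d} {R : realType}.
Variable P : probability T R.

Definition L0meas (f : T -> R) : Prop := measurable_fun setT f.
Definition aeq (f g : T -> R) : Prop := {ae P, forall t, f t = g t}.
Definition ale (f g : T -> R) : Prop := {ae P, forall t, f t <= g t}.
Definition alt (f g : T -> R) : Prop := {ae P, forall t, f t < g t}.
Definition L0pp (r : T -> R) : Prop := L0meas r /\ {ae P, forall t, 0 < r t}.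

(* countable measurable partition of Omega (finite ones are padded by empty sets) *)
Definition mpartition (A : nat -> set T) : Prop :=
  (forall k, measurable (A k)) /\ trivIset setT A /\ \bigcup_k A k = setT.

Record L0module := {
  Ecar :> Type;
  eadd : Ecar -> Ecar -> Ecar;
  ezero : Ecar;
  eopp : Ecar -> Ecar;
  esmul : (T -> R) -> Ecar -> Ecar;
  eaddA : forall x y z, eadd x (eadd y z) = eadd (eadd x y) z;
  eaddC : forall x y, eadd x y = eadd y x;
  eadd0 : forall x, eadd ezero x = x;
  eaddN : forall x, eadd (eopp x) x = ezero;
  esmulA : forall f g x, L0meas f -> L0meas g ->
    esmul f (esmul g x) = esmul (f \* g) x;
  esmul1 : forall x, esmul (fun _ => 1) x = x;
  esmulDl : forall f g x, L0meas f -> L0meas g ->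
    esmul (f \+ g) x = eadd (esmul f x) (esmul g x);
  esmulDr : forall f x y, L0meas f ->
    esmul f (eadd x y) = eadd (esmul f x) (esmul f y);
  esmul_ae : forall f g x, L0meas f -> L0meas g -> aeq f g ->
    esmul f x = esmul g x
}.

Definition cstn (k : nat) : T -> nat := fun _ => k.
Definition Lsnat (n : T -> nat) : Prop :=
  exists (A : nat -> set T) (nk : nat -> nat),
    mpartition A /\ forall k t, A k t -> n t = nk k.
Definition nle (n m : T -> nat) : Prop := {ae P, forall t, (n t <= m t)%N}.
Definition nlt (n m : T -> nat) : Prop := {ae P, forall t, (n t < m t)%N}.

Section Module.
Variable M : L0module.

(* y = sum_k 1_{A_k} x_k *)
Definition concat (A : nat -> set T) (x : nat -> M) (y : M) : Prop :=
  forall k, esmul (\1_(A k)) y = esmul (\1_(A k)) (x k).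

Definition stable_module : Prop :=
  forall A (x : nat -> M), mpartition A -> exists! y, concat A x y.

Definition stable_set (S : set M) : Prop :=
  S !=set0 /\
  forall A (x : nat -> M) y, mpartition A -> (forall k, S (x k)) ->
    concat A x y -> S y.

Definition sumset (A : nat -> set T) (Y : nat -> set M) : set M :=
  [set y | exists z : nat -> M, (forall k, Y k (z k)) /\ concat A z y].

Definition st (X : set M) : set M :=
  [set y | exists A (x : nat -> M),
     mpartition A /\ (forall k, X (x k)) /\ concat A x y].

Definition stable_finite (S N : set M) : Prop :=
  exists A (X : nat -> set M), mpartition A /\
    (forall k, finite_set (X k) /\ X k !=set0 /\ X k `<=` S) /\
    N = sumset A (fun k => st (X k)).

Definition stable_seq (x : (T -> nat) -> M) : Prop :=
  forall n A (nk : nat -> nat), Lsnat n -> mpartition A ->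
    (forall k, {ae P, forall t, A k t -> n t = nk k}) ->
    concat A (fun k => x (cstn (nk k))) (x n).

Definition stable_seq_sets (Rs : (T -> nat) -> set M) : Prop :=
  forall n A (nk : nat -> nat), Lsnat n -> mpartition A ->
    (forall k, {ae P, forall t, A k t -> n t = nk k}) ->
    Rs n = sumset A (fun k => Rs (cstn (nk k))).

Definition stable_index (nf : (T -> nat) -> (T -> nat)) : Prop :=
  (forall k, Lsnat k -> Lsnat (nf k)) /\
  (forall k A (kk : nat -> nat), Lsnat k -> mpartition A ->
    (forall j, {ae P, forall t, A j t -> k t = kk j}) ->
    forall j, {ae P, forall t, A j t -> nf k t = nf (cstn (kk j)) t}).
Definition increasing_index (nf : (T -> nat) -> (T -> nat)) : Prop :=
  forall k k', Lsnat k -> Lsnat k' -> nlt k k' -> nlt (nf k) (nf k').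

Definition seq_in (S : set M) (x : (T -> nat) -> M) : Prop :=
  forall n, Lsnat n -> S (x n).

Section Metric.
Variables (S : set M) (dm : M -> M -> T -> R).

Definition stable_metric : Prop :=
  (forall x y, S x -> S y -> L0meas (dm x y) /\ ale (fun _ => 0) (dm x y)) /\
  (forall x y, S x -> S y -> (aeq (dm x y) (fun _ => 0) <-> x = y)) /\
  (forall x y, S x -> S y -> aeq (dm x y) (dm y x)) /\
  (forall x y z, S x -> S y -> S z -> ale (dm x z) (dm x y \+ dm y z)) /\
  (forall A (x y : nat -> M) xx yy, mpartition A ->
     (forall k, S (x k) /\ S (y k)) -> concat A x xx -> concat A y yy ->
     forall k, {ae P, forall t, A k t -> dm xx yy t = dm (x k) (y k) t}).

Definition sball (x : M) (r : T -> R) : set M :=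
  [set y | S y /\ alt (dm x y) r].

Definition sopen (U : set M) : Prop :=
  U `<=` S /\ forall x, U x -> exists r, L0pp r /\ sball x r `<=` U.
Definition sclosed (C : set M) : Prop := C `<=` S /\ sopen (S `\` C).

Definition converges (x : (T -> nat) -> M) (l : M) : Prop :=
  forall r, L0pp r -> exists n0, Lsnat n0 /\
    forall n, Lsnat n -> nle n0 n -> alt (dm (x n) l) r.
Definition cauchy (x : (T -> nat) -> M) : Prop :=
  forall r, L0pp r -> exists n0, Lsnat n0 /\
    forall n m, Lsnat n -> Lsnat m -> nle n0 n -> nle n0 m ->
      ale (dm (x n) (x m)) r.

Definition stable_complete : Prop :=
  forall x, stable_seq x -> seq_in S x -> cauchy x ->
    exists l, S l /\ converges x l.
Definition stable_seq_compact : Prop :=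
  forall x, stable_seq x -> seq_in S x ->
    exists nf, stable_index nf /\ increasing_index nf /\
      exists l, S l /\ converges (fun k => x (nf k)) l.
Definition stable_totally_bounded : Prop :=
  forall r, L0pp r -> exists N, stable_finite S N /\
    S = \bigcup_(x in N) sball x r.

Definition sfilter (F : set (set M)) : Prop :=
  (forall U, F U -> U `<=` S) /\ F S /\ ~ F set0 /\
  (forall U V, F U -> F V -> F (U `&` V)) /\
  (forall U V, F U -> U `<=` V -> V `<=` S -> F V).
Definition stable_collection (B : set (set M)) : Prop :=
  (forall U, B U -> stable_set U) /\
  (forall A (U : nat -> set M), mpartition A -> (forall k, B (U k)) ->
     B (sumset A U)).
Definition stable_filter (F : set (set M)) : Prop :=
  sfilter F /\ exists B, B `<=` F /\ (forall U, F U -> exists V, B V /\ V `<=` U)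
                        /\ stable_collection B.
Definition cluster_point (F : set (set M)) (x : M) : Prop :=
  forall U, F U -> forall r, L0pp r -> exists y, U y /\ sball x r y.
Definition stable_compact : Prop :=
  forall F, stable_filter F -> exists x, S x /\ cluster_point F x.

Definition decreasing_closed_property : Prop :=
  forall Rs : (T -> nat) -> set M, stable_seq_sets Rs ->
    (forall n, Lsnat n -> stable_set (Rs n) /\ sclosed (Rs n)) ->
    (forall n m, Lsnat n -> Lsnat m -> nle n m -> Rs m `<=` Rs n) ->
    exists x, forall n, Lsnat n -> Rs n x.
End Metric.
End Module.
End StableL0.

(* Main.v *)
Require Import Defs.
From mathcomp Require Import all_boot all_order all_algebra.
From mathcomp Require Import all_classical all_reals all_analysis.
From mathcomp Require Import measurable_realfun lra.
Set Implicit Arguments.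
Unset Strict Implicit.
Unset Printing Implicit Defensive.
Import Order.TTheory GRing.Theory Num.Theory.
Local Open Scope classical_set_scope.
Local Open Scope ring_scope.

(* Everything is reduced to statements holding at almost every point t. A
   countable partition is the same as an index function n in L^0_s(N), and, by
   the stability of the metric, a concatenation y of (x_k) along n is
   characterised inside S by d(y, x_{n(t)})(t) = 0 for a.e. t. A stable sequence
   is thus an ordinary sequence in S, and random choices become measurable
   "least index" functions. The other tool is exhaustion: a family of measurable
   sets closed under countable unions has a largest element up to null sets.

   (i) => (ii): the sets R_n form a stable filter base, and its cluster points
   lie in every R_n.
   (ii) => (iii): apply (ii) to the closures of the tails of the sequence; the
   subsequence picks, pointwise, the least later index at distance < 1/(j+1).
   (iii) => (iv): given r, choose y_j greedily so that it is r-far from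
   y_0, ..., y_{j-1} on the largest possible set C_j. The C_j have null
   intersection, since on it (y_j) would be r-separated; so the first j with
   t outside C_j is a random finite number of centres that suffices.
   (iv) => (i): exhaustion over the filter base shows that some centre z_0,
   concatenated from a finite net, has a ball meeting all sets of the base.
   Cutting the base down to that ball and iterating with radii 1/(j+1) gives a
   Cauchy sequence whose limit is a cluster point. *)

(** * Exhaustion and measurable selection *)

Section AlmostEverywhere.
Context {d : measure_display} {T : measurableType d} {R : realType}.
Variable P : probability T R.

Lemma ae_mp (Q Q' : T -> Prop) :
  (\forall t \ae P, Q t) -> (\forall t \ae P, Q t -> Q' t) ->
  \forall t \ae P, Q' t.
Proof. by apply: filterS2 => t q; apply. Qed.

(** Choose members whose measures approach the supremum over [G]. Their union lies in [G] and
    attains it, so a member with positive mass outside this union would push the measure above the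
    supremum. *)
Lemma maximal_ae_set (G : set (set T)) :
  G !=set0 -> (forall A, G A -> measurable A) ->
  (forall A : nat -> set T, (forall k, G (A k)) -> G (\bigcup_k A k)) ->
  exists C, G C /\ forall A, G A -> \forall t \ae P, A t -> C t.
Proof.
move=> [A0 GA0] mG GU.
pose E := [set fine (P A) | A in G].
have Esup : has_sup E.
  split; first by exists (fine (P A0)), A0.
  exists 1 => _ [A GA <-].
  by rewrite -lee_fin fineK ?fin_num_measure ?probability_le1//; exact: mG.
have /choice[A HA] : forall k : nat, exists A,
    G A /\ sup E - k.+1%:R^-1 < fine (P A).
  move=> k; have /(sup_adherent)/(_ Esup)[_ [A GA <-] ltA] : 0 < (k.+1%:R^-1 : R).
    by rewrite invr_gt0.
  by exists A.
have GC : G (\bigcup_k A k) by apply: GU => k; exact: (HA k).1.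
exists (\bigcup_k A k); split=> // D GD.
set C := \bigcup_k A k in GC *.
have GDC : G (C `|` D).
  (* Closure is assumed for sequences only, so the union of two sets is written as that of the
     sequence C, D, D, ... *)
  have -> : C `|` D = \bigcup_k (if k == 0%N then C else D).
    apply/seteqP; split=> t.
      by case=> ?; [exists 0%N|exists 1%N].
    by case=> k _; case: ifP => _; [left|right].
  by apply: GU => k; case: ifP.
have mC := mG _ GC; have mD := mG _ GD; have mDC := mG _ GDC.
have le_C : fine (P (C `|` D)) <= fine (P C).
  apply: (@le_trans _ _ (sup E)).
    by apply: ub_le_sup; [exact: Esup.2|exists (C `|` D)].
  apply/ler_addgt0Pr => e e0.
  have [k] := ltr_add_invr e0; rewrite add0r => ke.
  apply: (@le_trans _ _ (fine (P (A k)) + k.+1%:R^-1)).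
    by rewrite -lerBlDr ltW// (HA k).2.
  rewrite lerD ?(ltW ke)// fine_le ?fin_num_measure//; first exact: mG (HA k).1.
  by apply: le_measure; rewrite ?inE//; [exact: mG (HA k).1|exact: bigcup_sup].
have D0 : P (D `\` C) = 0%E.
  have mDmC : measurable (D `\` C) by exact: measurableD.
  have := @measureU _ _ _ P C (D `\` C) mC mDmC (setDIK _ _).
  rewrite setDE setUIr setUv setIT => PU.
  apply/eqP; rewrite -fine_eq0 ?fin_num_measure//.
  move: le_C; rewrite PU fineD ?fin_num_measure// gerDl => le0.
  by rewrite eq_le le0 fine_ge0.
exists (D `\` C); split=> //; first exact: measurableD.
by move=> t /= /not_implyP[].
Qed.
End AlmostEverywhere.

Section IndexFunctions.
Context {d : measure_display} {T : measurableType d}.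
Implicit Types (n : T -> nat) (Q : nat -> set T).

Definition level n (k : nat) : set T := [set t | n t = k].

Lemma levelE n k t : level n k t <-> n t = k.
Proof. by []. Qed.

Lemma mpartition_level n : (forall k, measurable (level n k)) ->
  mpartition (level n).
Proof.
move=> mn; split=> //; split; last by apply/seteqP; split=> // t _; exists (n t).
apply/trivIsetP => i j _ _ /eqP ij; apply/seteqP; split=> // t [ni nj].
by apply: ij; rewrite -ni -nj.
Qed.

Lemma mpartition_index A : mpartition A ->
  exists n, Lsnat n /\ forall k t, A k t <-> n t = k.
Proof.
move=> pA; have [mA [tA cA]] := pA.
have /choice[n nP] : forall t, exists k, A k t.
  by move=> t; have : setT t by []; rewrite -cA => -[k _ Ak]; exists k.
have AP k t : A k t <-> n t = k.
  split=> [Akt|<-//].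
  by apply: (tA (n t) k) => //; exists t.
exists n; split=> //; exists A, id; split=> // k t; exact: (AP k t).1.
Qed.

(** This is the working form of membership in L^0_s(N). A level set is a union of pieces of the
    given partition; conversely the level sets themselves serve as the partition. *)
Lemma LsnatP n : Lsnat n <-> forall k, measurable (level n k).
Proof.
split=> [[A [nk [[mA [tA cA]] nA]]] k|mn]; last first.
  by exists (level n), id; split=> //; exact: mpartition_level.
have -> : level n k = \bigcup_(j in [set j | nk j = k]) A j.
  apply/seteqP; split=> t; last by move=> [j /= <- /nA].
  move=> /= ntk; have : setT t by [].
  by rewrite -cA => -[j _ Ajt]; exists j => //=; rewrite -ntk; exact/esym/nA.
by apply: bigcup_measurable.
Qed.

Lemma Lsnat_mpartition n : Lsnat n -> mpartition (level n).
Proof. by move=> /LsnatP; exact: mpartition_level. Qed.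

Lemma Lsnat_cst k : Lsnat (@cstn d T k).
Proof.
apply/LsnatP => j; case: (eqVneq k j) => [<-|kj].
  by rewrite (_ : level _ _ = setT)//; apply/seteqP; split.
rewrite (_ : level _ _ = set0)//; apply/seteqP; split=> // t e.
by rewrite -[k]/(cstn k t) e eqxx in kj.
Qed.

Lemma measurable_index_rel n (Q : nat -> set T) : Lsnat n ->
  (forall k, measurable (Q k)) -> measurable [set t | Q (n t) t].
Proof.
move=> /LsnatP mn mQ.
rewrite (_ : [set _ | _] = \bigcup_k (level n k `&` Q k)).
  by apply: bigcup_measurable => k _; exact: measurableI.
apply/seteqP; split=> t /=; first by move=> Qt; exists (n t).
by move=> [k _ [<-]].
Qed.

(** Permits an index to be picked at random: the level sets of the diagonal are assembled from those
    of [m k] on the event where [n] equals k. *)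
Lemma Lsnat_diag (m : nat -> T -> nat) n : (forall k, Lsnat (m k)) -> Lsnat n ->
  Lsnat (fun t => m (n t) t).
Proof.
move=> mm mn; apply/LsnatP => j.
apply: (@measurable_index_rel n (fun k => level (m k) j)) => // k.
by have /LsnatP := mm k; exact.
Qed.

Lemma Lsnat_comp2 (f : nat -> nat -> nat) n m : Lsnat n -> Lsnat m ->
  Lsnat (fun t => f (n t) (m t)).
Proof.
move=> mn mm; apply: (@Lsnat_diag (fun k t => f k (m t))) => // k.
apply: (@Lsnat_diag (fun j => @cstn d T (f k j))) => // j; exact: Lsnat_cst.
Qed.

(** The value 0 is prescribed where no index qualifies, so that the minimum becomes a total function
    whose level sets can be computed. *)
Lemma least_index_ex Q t : exists k,
  [/\ (exists j, Q j t) -> Q k t, forall j, Q j t -> (k <= j)%N &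
      (~ exists j, Q j t) -> k = 0%N].
Proof.
case: (pselect (exists j, Q j t)) => [ej|nej]; last first.
  by exists 0%N; split=> // j Qj; case: nej; exists j.
have eb : exists j, `[< Q j t >] by case: ej => j Qj; exists j; apply/asboolP.
case: (ex_minnP eb) => k /asboolP Qk mink.
by exists k; split=> // j /asboolP/mink.
Qed.

Definition least_index Q (t : T) : nat := sval (cid (least_index_ex Q t)).

Lemma least_index_mem Q t : (exists j, Q j t) -> Q (least_index Q t) t.
Proof. by rewrite /least_index; case: cid => k []. Qed.

Lemma least_index_min Q t j : Q j t -> (least_index Q t <= j)%N.
Proof. by rewrite /least_index; case: cid => k /= [_ h _]; exact: h. Qed.

Lemma least_index_junk Q t : (~ exists j, Q j t) -> least_index Q t = 0%N.
Proof. by rewrite /least_index; case: cid => k []. Qed.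

Lemma Lsnat_least Q : (forall k, measurable (Q k)) -> Lsnat (least_index Q).
Proof.
move=> mQ; apply/LsnatP => k.
(* Level 0 also collects the points outside every [Q j], because of the default value. *)
have -> : level (least_index Q) k = (Q k `\` \bigcup_(j < k) Q j) `|`
    (if k == 0%N then ~` \bigcup_j Q j else set0).
  apply/seteqP; split=> t; rewrite /level /=.
    case: (pselect (exists j, Q j t)) => [eQ|nQ].
      move=> <-; left; split; first exact: least_index_mem.
      by move=> [j /= + /least_index_min]; rewrite ltnNge => /negP.
    rewrite least_index_junk// => <-; right.
    by move=> [j _ Qj]; apply: nQ; exists j.
  case=> [[Qk nQ]|].
    apply/eqP; rewrite eqn_leq least_index_min//= leqNgt; apply/negP => lt_k.
    by apply: nQ; exists (least_index Q t) => //=; apply: least_index_mem; exists k.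
  case: eqVneq => // -> nQ; apply: least_index_junk.
  by move=> [j Qj]; apply: nQ; exists j.
apply: measurableU; first by apply: measurableD => //; exact: bigcup_measurable.
by case: ifP => // _; apply: measurableC; exact: bigcup_measurable.
Qed.
End IndexFunctions.

(** * Concatenations read off the metric *)

Section StableMetric.
Context {d : measure_display} {T : measurableType d} {R : realType}.
Variables (P : probability T R) (M : L0module P).
Variables (S : set M) (dm : M -> M -> T -> R).
Hypotheses (stM : stable_module M) (stS : stable_set S).
Hypothesis dS : stable_metric S dm.
Implicit Types (A : set T) (x y z : M) (n m : T -> nat).

Lemma dist_measurable x y : S x -> S y -> measurable_fun setT (dm x y).
Proof. by move=> Sx Sy; have [/(_ _ _ Sx Sy)[]] := dS. Qed.

Lemma dist_eq0 x y : S x -> S y -> (\forall t \ae P, dm x y t = 0) -> x = y.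
Proof. by move=> Sx Sy; have [_ [/(_ _ _ Sx Sy)[]]] := dS. Qed.

Lemma dist_xx x : S x -> \forall t \ae P, dm x x t = 0.
Proof. by move=> Sx; have [_ [h _]] := dS; exact: (h _ _ Sx Sx).2. Qed.

Lemma dist_sym x y : S x -> S y -> \forall t \ae P, dm x y t = dm y x t.
Proof. by move=> Sx Sy; have [_ [_ [/(_ _ _ Sx Sy)]]] := dS. Qed.

Lemma dist_triangle x y z : S x -> S y -> S z ->
  \forall t \ae P, dm x z t <= dm x y t + dm y z t.
Proof. by move=> Sx Sy Sz; have [_ [_ [_ [/(_ _ _ _ Sx Sy Sz)]]]] := dS. Qed.

Lemma dist_congr x x' y : S x -> S x' -> S y ->
  \forall t \ae P, dm x x' t = 0 -> dm x y t = dm x' y t.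
Proof.
move=> Sx Sx' Sy.
apply: ae_mp (dist_sym Sx Sx') _; apply: ae_mp (dist_triangle Sx Sx' Sy) _.
apply: ae_mp (dist_triangle Sx' Sx Sy) _; apply: aeW => t.
by move=> h1 h2 h3 h4; rewrite -h3 h4 in h1 h2; lra.
Qed.

Lemma dist_trans0 x y z : S x -> S y -> S z ->
  \forall t \ae P, dm x y t = 0 -> dm y z t = 0 -> dm x z t = 0.
Proof.
by move=> Sx Sy Sz; apply: filterS (dist_congr Sx Sy Sz) => t h /h ->.
Qed.

Lemma measurable_dist_lt x y r : S x -> S y -> L0meas r ->
  measurable [set t | dm x y t < r t].
Proof.
move=> Sx Sy mr; rewrite -[X in measurable X]setTI.
have := measurable_fun_ltr (dist_measurable Sx Sy) mr.
by move=> /(_ measurableT [set true]); exact.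
Qed.

Definition eqon A x y := esmul (\1_A) x = esmul (\1_A) y.

Definition cut A (t : T) : nat := if `[< A t >] then 0%N else 1%N.

Lemma cut0 A : level (cut A) 0 = A.
Proof.
by apply/seteqP; split=> t; rewrite /level /cut /=; case: asboolP.
Qed.

Lemma Lsnat_cut A : measurable A -> Lsnat (cut A).
Proof.
move=> mA; apply/LsnatP => -[|[|k]]; first by rewrite cut0.
  rewrite (_ : level _ _ = ~` A); first exact: measurableC.
  by apply/seteqP; split=> t; rewrite /level /cut /=; case: asboolP.
rewrite (_ : level _ _ = set0)//.
by apply/seteqP; split=> t; rewrite /level /cut /=; case: asboolP.
Qed.

(** Forward, x is the concatenation of y on A and x off A, and locality of the metric compares
    d(x,y) with d(y,y) on A. Conversely, concatenate x on A with y off A: the result is at distance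
    0 from y, hence equals y, and it agrees with x on A. *)
Lemma eqon_dist A x y : measurable A -> S x -> S y ->
  eqon A x y <-> \forall t \ae P, A t -> dm x y t = 0.
Proof.
move=> mA Sx Sy; have pA := Lsnat_mpartition (Lsnat_cut mA).
have [_ [_ [_ [_ loc]]]] := dS.
split=> [exy|dxy].
  have h : \forall t \ae P, level (cut A) 0 t -> dm x y t = dm y y t.
    apply: (loc _ (fun k : nat => if k is 0%N then y else x) (fun=> y) x y pA
      _ _ _ 0%N) => [[]//|[|k]//|//].
    by rewrite cut0.
  rewrite cut0 in h; apply: ae_mp h _; apply: filterS (dist_xx Sy) => t y0 h At.
  by rewrite h.
have [z [cz _]] := stM (fun k : nat => if k is 0%N then x else y) pA.
have Sz : S z by apply: (stS.2 _ _ _ pA _ cz) => -[].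
suff <- : z = y by have := cz 0%N; rewrite cut0 /eqon => ->.
apply: dist_eq0 => //.
have {}loc := loc _ (fun k : nat => if k is 0%N then x else y) (fun=> y) z y pA.
have h : \forall t \ae P, forall k, level (cut A) k t ->
    dm z y t = dm (if k is 0%N then x else y) y t.
  by apply: ae_foralln => k; apply: loc => //; case.
apply: ae_mp h _; apply: ae_mp (dist_xx Sy) _; apply: ae_mp dxy _.
apply: aeW => t dxy0 dyy0 /(_ (cut A t) erefl) ->.
by rewrite /cut; case: asboolP.
Qed.

Lemma concat_dist (A : nat -> set T) (x : nat -> M) y n :
  mpartition A -> (forall k t, A k t <-> n t = k) ->
  (forall k, S (x k)) -> S y ->
  concat A x y <-> \forall t \ae P, dm y (x (n t)) t = 0.
Proof.
move=> [mA _] An Sx Sy; split=> [cxy|dxy k].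
  have : \forall t \ae P, forall k, A k t -> dm y (x k) t = 0.
    by apply: ae_foralln => k; apply/eqon_dist => //; exact: cxy.
  by apply: filterS => t; apply; apply/An.
by apply/eqon_dist => //; apply: filterS dxy => t + /An <-.
Qed.

Lemma sumset_dist (A : nat -> set T) (Y : nat -> set M) y n :
  mpartition A -> (forall k t, A k t <-> n t = k) -> (forall k, Y k `<=` S) ->
  sumset A Y y <-> S y /\ exists z : nat -> M, (forall k, Y k (z k)) /\
    \forall t \ae P, dm y (z (n t)) t = 0.
Proof.
move=> pA An YS; split.
  move=> [z [Yz cz]]; have Sz k : S (z k) by exact: YS.
  have Sy : S y by exact: (stS.2 _ _ _ pA Sz cz).
  by split=> //; exists z; split=> //; exact: (concat_dist pA An Sz Sy).1.
move=> [Sy [z [Yz dz]]]; exists z; split=> //.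
by apply/(concat_dist pA An) => // k; exact: YS.
Qed.

Section StableSubset.
Variable V : set M.
Hypotheses (VS : V `<=` S) (stV : stable_set V).

Lemma glue_closed n (x : nat -> M) y : Lsnat n -> (forall k, V (x k)) -> S y ->
  (\forall t \ae P, dm y (x (n t)) t = 0) -> V y.
Proof.
move=> mn Vx Sy dy; have pn := Lsnat_mpartition mn.
have Sx k : S (x k) by exact: VS.
by apply: (stV.2 _ x _ pn) => //; apply: (concat_dist pn (levelE n) Sx Sy).2.
Qed.

(** The basic way to build points: with [V] the whole space it turns a measurable choice of indices
    into a point; with smaller stable [V] it keeps that point in [V]. *)
Lemma glue n (x : nat -> M) : Lsnat n -> (forall k, V (x k)) ->
  exists y, V y /\ \forall t \ae P, dm y (x (n t)) t = 0.
Proof.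
move=> mn Vx; have pn := Lsnat_mpartition mn.
have [y [cy _]] := stM x pn.
have Vy : V y by exact: (stV.2 _ x _ pn).
have Sx k : S (x k) by exact: VS.
exists y; split=> //; apply: (concat_dist pn (levelE n) Sx (VS Vy)).1 => //.
Qed.

Lemma glue2 A x y : measurable A -> V x -> V y ->
  exists z, V z /\
    \forall t \ae P, (A t -> dm z x t = 0) /\ (~ A t -> dm z y t = 0).
Proof.
move=> mA Vx Vy.
have [|z [Vz dz]] := glue (x := fun k => if k is 0%N then x else y) (Lsnat_cut mA).
  by case.
exists z; split=> //; apply: filterS dz => t.
by rewrite /cut; case: asboolP => // At dz0; split.
Qed.
End StableSubset.

Lemma stable_setP (V : set M) : V `<=` S -> V !=set0 ->
  (forall n (x : nat -> M) y, Lsnat n -> (forall k, V (x k)) -> S y ->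
    (\forall t \ae P, dm y (x (n t)) t = 0) -> V y) -> stable_set V.
Proof.
move=> VS V0 h; split=> // A x y pA Vx cy.
have Sx k : S (x k) by exact: VS.
have Sy : S y by exact: (stS.2 _ _ _ pA Sx cy).
have [n [mn An]] := mpartition_index pA.
by apply: (h n x y) => //; exact: (concat_dist pA An Sx Sy).1.
Qed.

Lemma stable_seq_dist (x : (T -> nat) -> M) n : stable_seq x -> seq_in S x ->
  Lsnat n -> \forall t \ae P, dm (x n) (x (cstn (n t))) t = 0.
Proof.
move=> stx Sx mn; have pn := Lsnat_mpartition mn.
have := stx n (level n) id mn pn.
move=> /(_ (fun k => aeW _ (fun t e => e))) cx.
apply: ((concat_dist (x := fun k => x (cstn k)) pn (levelE n) _ _).1 cx) => //.
  by move=> k; apply: Sx; exact: Lsnat_cst.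
exact: Sx.
Qed.

Lemma stable_seq_of (u : nat -> M) : (forall k, S (u k)) ->
  exists x : (T -> nat) -> M, [/\ stable_seq x, seq_in S x &
    forall n, Lsnat n -> \forall t \ae P, dm (x n) (u (n t)) t = 0].
Proof.
move=> Su.
have /choice[x xP] : forall n, exists y, Lsnat n ->
    S y /\ \forall t \ae P, dm y (u (n t)) t = 0.
  (* Nothing is required at a non-measurable index, so any value will do there. *)
  move=> n; have [mn|nn] := pselect (Lsnat n); last by exists (u 0%N).
  by have [y hy] := glue (@subset_refl _ S) stS mn Su; exists y.
exists x; split=> [n A nk mn pA nA|n mn|n mn]; last 2 first.
- by have [] := xP n mn.
- by have [] := xP n mn.
have xk k : x (cstn k) = u k.
  by have [Sxk dxk] := xP _ (Lsnat_cst k); exact: dist_eq0.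
under [X in concat _ X _]eq_fun do rewrite xk.
have [Sxn dxn] := xP n mn.
have [m [mm Am]] := mpartition_index pA.
apply/(concat_dist pA Am) => //; apply: ae_mp dxn _.
apply: filterS (ae_foralln nA) => t h.
by rewrite (h (m t))//; apply/Am.
Qed.

Lemma inv_le (i j : nat) : (i <= j)%N -> (j.+1%:R^-1 : R) <= i.+1%:R^-1.
Proof. by move=> ij; rewrite lef_pV2 ?posrE// ler_nat. Qed.

Lemma L0pp_inv (j : nat) : L0pp P (fun=> j.+1%:R^-1).
Proof. by split; [exact: measurable_cst|apply: aeW => t; rewrite invr_gt0]. Qed.

Lemma L0pp_scale (c : R) r : 0 < c -> L0pp P r -> L0pp P (fun t => c * r t).
Proof.
move=> c0 [mr r0]; split.
  by apply: measurable_funM => //; exact: measurable_cst.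
by apply: filterS r0 => t; exact: mulr_gt0.
Qed.

(** The Archimedean property applied pointwise; the least suitable integer is a measurable choice.
    Random radii can thus be replaced by 1/(n+1) with a random n. *)
Lemma L0pp_index (r : T -> R) : L0pp P r ->
  exists n, Lsnat n /\ \forall t \ae P, (n t).+1%:R^-1 < r t.
Proof.
move=> [mr r0].
exists (least_index (fun j => [set t | j.+1%:R^-1 < r t])); split.
  apply: Lsnat_least => j; rewrite -[X in measurable X]setTI.
  have mj : measurable_fun [set: T] (fun=> j.+1%:R^-1 : R) by exact: measurable_cst.
  by have /(_ measurableT [set true]) := measurable_fun_ltr mj mr; exact.
apply: filterS r0 => t /ltr_add_invr[j]; rewrite add0r => jr.
apply: (@least_index_mem _ _ (fun j => [set t | j.+1%:R^-1 < r t])).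
by exists j.
Qed.

Lemma dist_sym0 x y : S x -> S y ->
  \forall t \ae P, dm x y t = 0 -> dm y x t = 0.
Proof. by move=> Sx Sy; apply: filterS (dist_sym Sx Sy) => t ->. Qed.

Lemma dist_join0 x y z : S x -> S y -> S z ->
  \forall t \ae P, dm x z t = 0 -> dm y z t = 0 -> dm x y t = 0.
Proof.
move=> Sx Sy Sz; apply: ae_mp (dist_sym0 Sy Sz) _.
by apply: filterS (dist_trans0 Sx Sz Sy) => t h s xz /s; exact: h.
Qed.

Lemma sclosedP (C : set M) : C `<=` S ->
  sclosed S dm C <-> forall y, S y ->
    (forall r, L0pp P r -> exists z, C z /\ sball S dm y r z) -> C y.
Proof.
move=> CS; split=> [[_ [_ oC]] y Sy yC|h].
  apply: contrapT => nCy; have [|r [r0 rC]] := oC y; first by split.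
  by have [z [Cz /rC[]]] := yC r r0.
split=> //; split=> [y []//|y [Sy nCy]].
apply: contrapT => nr; apply: nCy; apply: h => // r r0.
apply: contrapT => nz; apply: nr; exists r; split=> // z zr; split; first by case: zr.
by move=> Cz; apply: nz; exists z.
Qed.

(** * Compactness and decreasing closed sets *)

Section DecreasingSets.
Variable Rs : (T -> nat) -> set M.
Hypotheses (stRs : stable_seq_sets Rs)
  (clRs : forall n, Lsnat n -> stable_set (Rs n) /\ sclosed S dm (Rs n))
  (decRs : forall n m, Lsnat n -> Lsnat m -> nle P n m -> Rs m `<=` Rs n).

Lemma Rs_sub n : Lsnat n -> Rs n `<=` S.
Proof. by move=> /clRs[_ []]. Qed.

Lemma Rs_cstP n y : Lsnat n -> Rs n y <->
  S y /\ exists z : nat -> M, (forall j, Rs (cstn j) (z j)) /\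
    \forall t \ae P, dm y (z (n t)) t = 0.
Proof.
move=> mn; have pn := Lsnat_mpartition mn.
rewrite (stRs mn pn (fun k => aeW _ (fun t e => e))).
apply: sumset_dist => // k; apply: Rs_sub; exact: Lsnat_cst.
Qed.

(** This makes the sets [Rs n] a stable collection: concatenating members of it only evaluates the
    sequence at the diagonal index. *)
Lemma sumset_Rs (A : nat -> set T) (ns : nat -> T -> nat) m : mpartition A -> Lsnat m ->
  (forall k t, A k t <-> m t = k) -> (forall k, Lsnat (ns k)) ->
  sumset A (fun k => Rs (ns k)) = Rs (fun t => ns (m t) t).
Proof.
move=> pA mm Am mns; have mn := Lsnat_diag mns mm.
have cS j : Rs (cstn j) `<=` S by apply: Rs_sub; exact: Lsnat_cst.
have cst_st j : stable_set (Rs (cstn j)) by have [] := clRs (Lsnat_cst j).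
have nS k : Rs (ns k) `<=` S by exact: Rs_sub.
apply/seteqP; split=> y.
  move=> /(sumset_dist _ pA Am nS)[Sy [w [Rw dyw]]].
  have Sw k : S (w k) by exact: nS (Rw k).
  have /choice[z hz] : forall k, exists z : nat -> M, (forall j, Rs (cstn j) (z j)) /\
    \forall t \ae P, dm (w k) (z (ns k t)) t = 0.
    by move=> k; have /Rs_cstP[] := Rw k.
  have Sz k j : S (z k j) by exact: cS ((hz k).1 j).
  (* With j fixed, the representatives [z k j] are glued along [m], which stays inside the one
     stable set [Rs (cstn j)]. *)
  have /choice[v hv] : forall j, exists v, Rs (cstn j) v /\
      \forall t \ae P, dm v (z (m t) j) t = 0.
    by move=> j; apply: (@glue _ (cS j) (cst_st j) m (z^~ j)) => // k; exact: (hz k).1.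
  have Sv j : S (v j) by exact: cS (hv j).1.
  apply/Rs_cstP => //; split=> //; exists v; split=> [j|]; first exact: (hv j).1.
  apply: ae_mp dyw _.
  apply: ae_mp (ae_foralln (fun k => (hz k).2)) _.
  apply: ae_mp (ae_foralln (fun j => (hv j).2)) _.
  apply: ae_mp (ae_foralln (fun k => ae_foralln (fun j =>
    dist_trans0 Sy (Sw k) (Sz k j)))) _.
  apply: ae_mp (ae_foralln (fun k => ae_foralln (fun j =>
    dist_join0 Sy (Sv j) (Sz k j)))) _.
  apply: aeW => t h1 h2 h3 h4 h5.
  by apply: (h1 (m t)); [exact: h2 h5 (h4 _)|exact: h3].
move=> /(Rs_cstP _ mn)[Sy [z [Rz dz]]].
have Sz j : S (z j) by exact: cS (Rz j).
suff /choice[w hw] : forall k, exists w, Rs (ns k) w /\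
    \forall t \ae P, m t = k -> dm y w t = 0.
  apply/(sumset_dist _ pA Am nS); split=> //; exists w; split=> [k|].
    exact: (hw k).1.
  by apply: filterS (ae_foralln (fun k => (hw k).2)) => t; exact.
(* The component [w] must lie in [Rs (ns k)] on the whole space, while y is known to be suitable
   only where [m] equals k. Elsewhere it is completed by an arbitrary element v of [Rs (ns k)]. *)
move=> k; have [[v Rv] _] := (clRs (mns k)).1.
have Sv := nS _ _ Rv.
have /Rs_cstP[//|_ [z' [Rz' dz']]] := Rv.
have Sz' j : S (z' j) by exact: cS (Rz' j).
have mk : measurable (level m k) by have /LsnatP := mm; exact.
have [w [Sw dw]] := glue2 (@subset_refl _ S) stS mk Sy Sv.
exists w; split; last first.
  apply: ae_mp dw _; apply: filterS (dist_sym0 Sw Sy) => t h [dw _] /dw.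
  exact: h.
have /choice[u hu] := fun j => glue2 (cS j) (cst_st j) mk (Rz j) (Rz' j).
have Su j : S (u j) by exact: cS (hu j).1.
apply/Rs_cstP => //; split=> //; exists u; split=> [j|]; first exact: (hu j).1.
apply: ae_mp dz _; apply: ae_mp dz' _; apply: ae_mp dw _.
apply: ae_mp (ae_foralln (fun j => (hu j).2)) _.
apply: ae_mp (ae_foralln (fun j => dist_trans0 Sw Sy (Sz j))) _.
apply: ae_mp (ae_foralln (fun j => dist_trans0 Sw Sv (Sz' j))) _.
apply: ae_mp (ae_foralln (fun j => dist_join0 Sw (Su j) (Sz j))) _.
apply: ae_mp (ae_foralln (fun j => dist_join0 Sw (Su j) (Sz' j))) _.
apply: aeW => t jz' jz tz' tz uP wP vz' yz.
have [mtk|nmtk] := pselect (level m k t).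
  rewrite mtk in yz.
  by apply: jz; [exact: tz (wP.1 mtk) yz|exact: (uP _).1].
by apply: jz'; [exact: tz' (wP.2 nmtk) vz'|exact: (uP _).2].
Qed.

Lemma compact_bigcap_nonempty : stable_compact S dm ->
  exists x, forall n, Lsnat n -> Rs n x.
Proof.
move=> cS.
pose F := [set U | U `<=` S /\ exists n, Lsnat n /\ Rs n `<=` U].
pose B := [set U | exists n, Lsnat n /\ U = Rs n].
have FR n : Lsnat n -> F (Rs n).
  by move=> mn; split; [exact: Rs_sub|exists n; split].
have [] := cS F; last first.
  move=> x [Sx Fx]; exists x => n mn.
  have /(sclosedP (Rs_sub mn)) := (clRs mn).2; apply=> // r r0.
  exact: Fx (FR _ mn) _ r0.
split.
  split; first by move=> U [].
  split; first by split=> //; exists (cstn 0); split;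
    [exact: Lsnat_cst|exact/Rs_sub/Lsnat_cst].
  split; first by move=> [_ [n [mn n0]]]; have [[[x Rx] _] _] := clRs mn; exact: n0 Rx.
  split=> [U V [US [n [mn nU]]] [VS [m [mm mV]]]|U V [_ [n [mn nU]]] UV VS]; last first.
    by split=> //; exists n; split=> //; exact: subset_trans UV.
  split; first by move=> x [/US].
  (* Monotonicity puts R at the pointwise maximum below both sets, which gives the finite
     intersection property. *)
  have mnm : Lsnat (fun t => maxn (n t) (m t)) by exact: Lsnat_comp2.
  exists (fun t => maxn (n t) (m t)); split=> //.
  rewrite subsetI; split.
    apply: subset_trans nU; apply: decRs => //; apply: aeW => t; exact: leq_maxl.
  apply: subset_trans mV; apply: decRs => //; apply: aeW => t; exact: leq_maxr.
exists B; split; first by move=> _ [n [mn ->]]; exact: FR.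
split; first by move=> U [_ [n [mn nU]]]; exists (Rs n); split=> //; exists n.
split; first by move=> _ [n [mn ->]]; exact: (clRs mn).1.
move=> A U pA /choice[ns hns].
have [m [mm Am]] := mpartition_index pA.
exists (fun t => ns (m t) t); split; first by apply: Lsnat_diag => // k; exact: (hns k).1.
rewrite -(sumset_Rs pA mm Am); last by move=> k; exact: (hns k).1.
by congr sumset; apply/funext => k; exact: (hns k).2.
Qed.
End DecreasingSets.

Lemma stable_compact_decreasing :
  stable_compact S dm -> decreasing_closed_property S dm.
Proof. by move=> cS Rs stRs clRs decRs; exact: compact_bigcap_nonempty. Qed.

Lemma dist_congr_r x y y' : S x -> S y -> S y' ->
  \forall t \ae P, dm y y' t = 0 -> dm x y t = dm x y' t.
Proof.
move=> Sx Sy Sy'; apply: ae_mp (dist_sym Sx Sy) _.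
apply: ae_mp (dist_sym Sx Sy') _.
by apply: filterS (dist_congr Sy Sy' Sx) => t h -> -> /h.
Qed.

(** * Tails and subsequences *)

Section TailCluster.
Variable u : nat -> M.
Hypothesis Su : forall k, S (u k).

(* The closure of the tail [{u_k : k >= n}], written pointwise. *)
Definition tail_cluster n : set M := [set y | S y /\
  \forall t \ae P, forall j, exists k, (n t <= k)%N /\ dm (u k) y t < j.+1%:R^-1].

Lemma tail_cluster_glue n m (z : nat -> M) y : (forall i, S (z i)) -> S y ->
  (\forall t \ae P, dm y (z (m t)) t = 0) ->
  (\forall t \ae P, forall j, exists k,
    (n t <= k)%N /\ dm (u k) (z (m t)) t < j.+1%:R^-1) ->
  tail_cluster n y.
Proof.
move=> Sz Sy dy dz; split=> //; apply: ae_mp dy _; apply: ae_mp dz _.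
apply: filterS (ae_foralln (fun k => ae_foralln (fun i => dist_congr_r (Su k) Sy (Sz i)))).
move=> t h hz hy j; have [k [nk dk]] := hz j.
by exists k; split=> //; rewrite (h _ _ hy).
Qed.

Lemma tail_cluster_stable n : Lsnat n -> stable_set (tail_cluster n).
Proof.
move=> mn; apply: stable_setP => [y []//||m x y mm hx Sy dy].
  have [y [Sy dy]] := glue (@subset_refl _ S) stS mn Su; exists y.
  apply: (tail_cluster_glue Su Sy dy).
  apply: filterS (ae_foralln (fun k => dist_xx (Su k))) => t h j.
  by exists (n t); split=> //; rewrite h invr_gt0.
apply: (tail_cluster_glue (fun k => (hx k).1) Sy dy).
by apply: filterS (ae_foralln (fun k => (hx k).2)) => t; exact.
Qed.

Lemma tail_cluster_closed n : sclosed S dm (tail_cluster n).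
Proof.
apply/sclosedP => [y []//|y Sy hy]; split=> //.
have /choice[z hz] := fun j => hy _ (L0pp_inv j).
have Sz j : S (z j) by have [[]] := hz j.
apply: ae_mp (ae_foralln (fun j => (hz j).1.2)) _.
apply: ae_mp (ae_foralln (fun j => (hz j).2.2)) _.
apply: ae_mp (ae_foralln (fun j => dist_sym Sy (Sz j))) _.
apply: filterS (ae_foralln (fun k => ae_foralln (fun j =>
  dist_triangle (Su k) (Sz j) Sy))) => t tri sy dz hz' j.
(* Index 2j+1 stands for the radius 1/(2j+2), half of 1/(j+1): one half for u_k to z, one for z to
   y. *)
have [k [nk dk]] := hz' (j.*2.+1) (j.*2.+1); exists k; split=> //.
have := tri k (j.*2.+1); have := dz (j.*2.+1); rewrite sy.
suff -> : (j.+1%:R^-1 : R) = (j.*2.+1).+1%:R^-1 + (j.*2.+1).+1%:R^-1.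
  by move=> dzy /le_lt_trans; apply; exact: ltrD.
rewrite -doubleS -muln2 natrM invfM -mulrDr.
by rewrite (_ : 2^-1 + 2^-1 = 1 :> R) ?mulr1//; lra.
Qed.

Lemma tail_cluster_seq : stable_seq_sets tail_cluster.
Proof.
move=> n A nk mn pA nA; have [m [mm Am]] := mpartition_index pA.
have mA := pA.1.
have tS k : tail_cluster (cstn (nk k)) `<=` S by move=> y [].
apply/seteqP; split=> y; last first.
  move=> /(sumset_dist _ pA Am tS)[Sy [z [hz dy]]].
  apply: (tail_cluster_glue (fun k => (hz k).1) Sy dy).
  apply: ae_mp (ae_foralln (fun k => (hz k).2)) _.
  apply: filterS (ae_foralln nA) => t e h j.
  by rewrite (e (m t)); [exact: h|apply/Am].
move=> [Sy hy]; apply/(sumset_dist _ pA Am tS); split=> //.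
suff /choice[w hw] : forall k, exists w, tail_cluster (cstn (nk k)) w /\
    \forall t \ae P, A k t -> dm y w t = 0.
  exists w; split=> [k|]; first exact: (hw k).1.
  by apply: filterS (ae_foralln (fun k => (hw k).2)) => t h; apply: h; apply/Am.
(* Off [A k] the point y need not belong to the tail starting at [nk k], so it is replaced there by
   [u (nk k)], which does. *)
move=> k.
have [w [Sw dw]] := glue2 (@subset_refl _ S) stS (mA k) Sy (Su (nk k)).
exists w; split; last first.
  by apply: ae_mp dw _; apply: filterS (dist_sym0 Sw Sy) => t h [dw _] /dw/h.
apply: (@tail_cluster_glue _ (cut (A k)) (fun i => if i is 0%N then y else u (nk k))).
- by case.
- by [].
- by apply: filterS dw => t [h1 h2]; rewrite /cut; case: asboolP.
apply: ae_mp (dist_xx (Su (nk k))) _; apply: ae_mp hy _.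
apply: filterS (nA k) => t e hy d0 j; rewrite /cut; case: asboolP => At.
  by rewrite /cstn -e.
by exists (nk k); split=> //; rewrite d0 invr_gt0.
Qed.

Lemma tail_cluster_decreasing n m : nle P n m -> tail_cluster m `<=` tail_cluster n.
Proof.
move=> nm y [Sy hy]; split=> //; apply: ae_mp hy _; apply: filterS nm.
by move=> t nm h j; have [k [mk dk]] := h j; exists k; split=> //; exact: leq_trans mk.
Qed.

Section Subsequence.
Variable l : M.
Hypotheses (Sl : S l) (ul : forall n, Lsnat n -> tail_cluster n l).

(** Stage j uses the radius 1/(j+1), and each stage looks strictly beyond the index of the previous
    one. Where no index qualifies the default 0 appears; the clustering hypothesis on [l] makes that
    event null. *)
Fixpoint approach (j : nat) : T -> nat :=
  if j is i.+1 then
    least_index (fun k =>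
      [set t | (approach i t < k)%N] `&` [set t | dm (u k) l t < i.+2%:R^-1])
  else least_index (fun k => [set t | dm (u k) l t < 1%:R^-1]).

Lemma Lsnat_approach j : Lsnat (approach j).
Proof.
have mu k (i : nat) : measurable [set t | dm (u k) l t < i.+1%:R^-1].
  by apply: measurable_dist_lt => //; exact: measurable_cst.
elim: j => [|j ih] /=; apply: Lsnat_least => k; first exact: mu.
apply: measurableI; last exact: mu.
apply: (@measurable_index_rel _ _ _ (fun i => [set _ | (i < k)%N])) => // i.
have [ik|ki] := ltnP i k.
  by rewrite (_ : [set _ | _] = setT)//; apply/seteqP; split.
by rewrite (_ : [set _ | _] = set0)//; apply/seteqP; split.
Qed.

Lemma approach_spec : \forall t \ae P, forall j,
  dm (u (approach j t)) l t < j.+1%:R^-1 /\ (approach j t < approach j.+1 t)%N.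
Proof.
(* Clustering is used at all constant starting indices simultaneously, so that at a fixed t the
   start may be the random value [approach j t] plus one. *)
apply: filterS (ae_foralln (fun i => (ul (Lsnat_cst i)).2)) => t h.
have hl (i j : nat) : exists k, (i <= k)%N /\ dm (u k) l t < j.+1%:R^-1.
  exact: h.
have hS j : (approach j t < approach j.+1 t)%N /\
    dm (u (approach j.+1 t)) l t < j.+2%:R^-1.
  apply: (@least_index_mem _ _ (fun k => [set t | (approach j t < k)%N] `&`
    [set t | dm (u k) l t < j.+2%:R^-1])).
  by have [k [? ?]] := hl (approach j t).+1 j.+1; exists k.
move=> j; split; last exact: (hS j).1.
case: j => [|j]; last exact: (hS j).2.
apply: (@least_index_mem _ _ (fun k => [set t | dm (u k) l t < 1%:R^-1])).
by have [k [_ ?]] := hl 0%N 0%N; exists k.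
Qed.

Lemma approach_increasing : \forall t \ae P, forall i j, (i < j)%N ->
  (approach i t < approach j t)%N.
Proof.
apply: filterS approach_spec => t h.
exact: (@homo_ltn _ (approach^~ t) (fun a b => (a < b)%N) ltn_trans
  (fun i => (h i).2)).
Qed.
End Subsequence.
End TailCluster.

Lemma decreasing_closed_seq_compact :
  decreasing_closed_property S dm -> stable_seq_compact S dm.
Proof.
move=> dec x stx Sx; pose u k := x (cstn k).
have Su k : S (u k) by apply: Sx; exact: Lsnat_cst.
have [|||l hl] := dec (tail_cluster u).
- exact: tail_cluster_seq.
- by move=> n mn; split; [exact: tail_cluster_stable|exact: tail_cluster_closed].
- by move=> n m _ _; exact: tail_cluster_decreasing.
have Sl : S l by have [] := hl _ (Lsnat_cst 0).
(* A random k selects the stage [k t] at each point; the subsequence is therefore stable by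
   construction. *)
pose nf (k : T -> nat) t := approach u l (k t) t.
have mnf k : Lsnat k -> Lsnat (nf k).
  by move=> mk; apply: Lsnat_diag => // j; exact: Lsnat_approach.
exists nf; split.
  split=> // k A kk mk pA kA j.
  by apply: filterS (kA j) => t h /h; rewrite /nf /cstn => ->.
split.
  move=> k k' mk mk' lt_k; apply: ae_mp lt_k _.
  by apply: filterS (approach_increasing hl) => t h; exact: h.
exists l; split=> // r /L0pp_index[n0 [mn0 n0r]]; exists n0; split=> // n mn le_n.
apply: ae_mp n0r _; apply: ae_mp le_n _.
apply: ae_mp (stable_seq_dist stx Sx (mnf n mn)) _.
apply: ae_mp (approach_spec hl) _.
apply: filterS (ae_foralln (fun k => dist_congr (Sx _ (mnf n mn)) (Su k) Sl)).
move=> t h hs hx le_n n0r; rewrite (h _ hx).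
apply: lt_le_trans (hs (n t)).1 _; apply: le_trans (ltW n0r); exact: inv_le.
Qed.

(** * Completeness and total boundedness *)

(** Constant indices are handled by induction at a fixed t; stability of [nf] transfers the bound to
    a random k. *)
Lemma increasing_index_ge (nf : (T -> nat) -> T -> nat) k : stable_index P nf ->
  increasing_index P nf -> Lsnat k -> nle P k (nf k).
Proof.
move=> [mnf stnf] incnf mk.
have inc j : \forall t \ae P, (nf (cstn j) t < nf (cstn j.+1) t)%N.
  by apply: incnf; [exact: Lsnat_cst|exact: Lsnat_cst|apply: aeW => t /=].
have nfk := stnf k (level k) id mk (Lsnat_mpartition mk)
  (fun j => aeW _ (fun t e => e)).
apply: ae_mp (ae_foralln inc) _; apply: filterS (ae_foralln nfk) => t hk incj.
rewrite (hk (k t))//; elim: (k t) => // j ih; exact: leq_ltn_trans (incj j).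
Qed.

Lemma seq_compact_complete : stable_seq_compact S dm -> stable_complete S dm.
Proof.
move=> sc x stx Sx cau; have [nf [stnf [incnf [l [Sl xl]]]]] := sc x stx Sx.
exists l; split=> // r rpp; have r0 := rpp.2.
have r3 : L0pp P (fun t => 3^-1 * r t) by apply: L0pp_scale.
have [n0 [mn0 hn0]] := cau _ r3; have [k0 [mk0 hk0]] := xl _ r3.
exists n0; split=> // n mn n0n.
(* Beyond [k0] the subsequence is near l, and [nf k] is at least k, hence beyond [n0], where the
   Cauchy bound compares it with [x n]. The two errors are at most r/3 each. *)
pose k t := maxn (n0 t) (k0 t).
have mk : Lsnat k by exact: Lsnat_comp2.
have mnfk := stnf.1 _ mk.
have n0k : nle P n0 (nf k).
  apply: filterS (increasing_index_ge stnf incnf mk) => t; apply: leq_trans.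
  exact: leq_maxl.
have k0k : nle P k0 k by apply: aeW => t; exact: leq_maxr.
apply: ae_mp (hn0 _ _ mn mnfk n0n n0k) _; apply: ae_mp (hk0 _ mk k0k) _.
apply: ae_mp r0 _.
apply: filterS (dist_triangle (Sx _ mn) (Sx _ mnfk) Sl) => t h1 h2 h3 h4.
by lra.
Qed.

(** A random finite net: one sequence of centres, of which only the first [p t] count at t. It
    replaces the unions of concatenated finite sets in the definition of stable finiteness. *)
Definition covers (r : T -> R) (y : nat -> M) (p : T -> nat) :=
  [/\ Lsnat p, forall i, S (y i) &
    forall x, S x -> \forall t \ae P, exists i, (i < p t)%N /\ dm (y i) x t < r t].

Lemma covers_totally_bounded :
  (forall r, L0pp P r -> exists (y : nat -> M) p, covers r y p) ->
  stable_totally_bounded S dm.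
Proof.
move=> cov r rpp; have [y [p [mp Sy hy]]] := cov r rpp.
have pp := Lsnat_mpartition mp.
(* Where [p] equals k, the first k+1 centres are allowed rather than k, which keeps the finite set
   nonempty for k = 0. *)
exists (sumset (level p) (fun k => st (y @` `I_k.+1))); split.
  exists (level p), (fun k => y @` `I_k.+1); split=> //; split=> // k.
  split; first exact/finite_image/finite_II.
  split; first by exists (y 0%N), 0%N.
  by move=> _ [i _ <-].
apply/seteqP; split=> x; last by move=> [z _ []].
move=> Sx.
pose Q i := [set t | dm (y i) x t < r t].
have mn : Lsnat (least_index Q).
  by apply: Lsnat_least => i; exact: measurable_dist_lt rpp.1.
pose n := least_index Q.
have nP : \forall t \ae P, (n t < p t)%N /\ dm (y (n t)) x t < r t.
  apply: filterS (hy x Sx) => t [i [ip di]]; split.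
    by apply: leq_ltn_trans ip; exact: least_index_min.
  by apply: (@least_index_mem _ _ Q); exists i.
have [z [Sz dz]] := glue (@subset_refl _ S) stS mn Sy.
(* Each component must use only the first k+1 centres everywhere, hence the truncation; it changes
   nothing where [p] equals k, since the chosen index is below [p] almost everywhere. *)
have mnk k : Lsnat (fun t => minn (n t) k).
  by apply: (@Lsnat_comp2 _ _ minn n (cstn k)) => //; exact: Lsnat_cst.
have /choice[w hw] := fun k => glue (@subset_refl _ S) stS (mnk k) Sy.
have Sw k : S (w k) := (hw k).1.
exists z; last first.
  split=> //; apply: ae_mp dz _; apply: ae_mp nP _.
  apply: filterS (ae_foralln (fun i => dist_congr Sz (Sy i) Sx)).
  by move=> t h [_ lt_r] /h ->.
exists w; split.
  move=> k; exists (level (fun t => minn (n t) k)), (fun i => y (minn i k)).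
  have pk := Lsnat_mpartition (mnk k).
  split=> //; split; first by move=> i; exists (minn i k) => //=; rewrite ltnS geq_minr.
  apply/(concat_dist pk (levelE _)) => //.
  by apply: filterS (hw k).2 => t; rewrite -minnA minnn.
apply/(concat_dist pp (levelE p)) => //.
apply: ae_mp nP _; apply: ae_mp dz _; apply: ae_mp (ae_foralln (fun k => (hw k).2)) _.
apply: filterS (ae_foralln (fun k => ae_foralln (fun i => dist_join0 Sz (Sw k) (Sy i)))).
move=> t h dw dz' [np _]; apply: (h _ (n t)) => //.
by have := dw (p t); rewrite (minn_idPl (ltnW np)).
Qed.

Lemma finite_enum (X : set M) : finite_set X -> X !=set0 ->
  exists (e : nat -> M) (b : nat), (forall i, X (e i)) /\
    forall w, X w -> exists i, (i < b)%N /\ e i = w.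
Proof.
move=> [b Xb] [x0 Xx0].
have /card_set_bijP[f [fI finj _]] := Xb.
(* [e] inverts the injection [f], padded by [x0] at integers outside its image. *)
have /choice[e he] : forall i, exists w, X w /\
    forall v, X v -> f v = i -> f w = i.
  move=> i; have [[v [Xv fv]]|nv] := pselect (exists v, X v /\ f v = i).
    by exists v.
  by exists x0; split=> // v Xv fv; case: nv; exists v.
exists e, b; split=> [i|w Xw]; first exact: (he i).1.
exists (f w); split; first exact: fI.
apply: finj; rewrite ?inE//; first exact: (he _).1.
exact: (he (f w)).2 Xw erefl.
Qed.

Lemma st_dist (X : set M) y : X `<=` S -> st X y ->
  exists (m : T -> nat) (w : nat -> M), [/\ S y, forall k, X (w k) &
    \forall t \ae P, dm y (w (m t)) t = 0].
Proof.
move=> XS [A [w [pA [Xw cw]]]]; have [m [mm Am]] := mpartition_index pA.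
have Sw k : S (w k) by exact: XS.
have Sy : S y by exact: (stS.2 _ _ _ pA Sw cw).
by exists m, w; split=> //; apply/(concat_dist pA Am).
Qed.

Lemma totally_bounded_covers : stable_totally_bounded S dm ->
  forall r, L0pp P r -> exists (y : nat -> M) p, covers r y p.
Proof.
move=> tb r rpp; have [N [[A [X [pA [hX NE]]]] SE]] := tb r rpp.
have [m [mm Am]] := mpartition_index pA.
have XS k : X k `<=` S by have [_ []] := hX k.
have /choice[e /choice[b heb]] : forall k, exists (e : nat -> M) (b : nat),
    (forall i, X k (e i)) /\ forall w, X k w -> exists i, (i < b)%N /\ e i = w.
  by move=> k; have [fX [X0 _]] := hX k; exact: finite_enum.
have Se k i : S (e k i) by apply: (XS k); exact: (heb k).1.
(* The i-th centre is, on each piece [A k], the i-th element of the enumeration of [X k]; the number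
   of centres to inspect is then [b (m t)]. *)
have /choice[y hy] := fun i => @glue _ (@subset_refl _ S) stS m (e^~ i) mm (Se^~ i).
have Sy i : S (y i) := (hy i).1.
exists y, (fun t => b (m t)); split=> // [|x Sx].
  by apply: (@Lsnat_diag _ _ (fun k => cstn (b k))) => // k; exact: Lsnat_cst.
have [z Nz [_ zx]] : (\bigcup_(z in N) sball S dm z r) x by rewrite -SE.
have stS' k : st (X k) `<=` S by move=> v /(st_dist (XS k))[? [? []]].
move: Nz; rewrite NE => /(sumset_dist _ pA Am stS')[Sz [v [stv dz]]].
have /choice[n /choice[w hw]] := fun k => st_dist (XS k) (stv k).
have Sv k : S (v k) by have [] := hw k.
have Xw k i : X k (w k i) by have [_ + _] := hw k; exact.
have dw k : \forall t \ae P, dm (v k) (w k (n k t)) t = 0 by have [] := hw k.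
have Sw k i : S (w k i) by exact: XS (Xw k i).
apply: ae_mp zx _; apply: ae_mp dz _; apply: ae_mp (ae_foralln dw) _.
apply: ae_mp (ae_foralln (fun i => (hy i).2)) _.
apply: ae_mp (ae_foralln (fun k => dist_congr Sz (Sv k) Sx)) _.
apply: ae_mp (ae_foralln (fun k => ae_foralln (fun i => dist_congr (Sv k) (Sw k i) Sx))) _.
apply: ae_mp (ae_foralln (fun k => ae_foralln (fun i => dist_congr (Sy i) (Se k i) Sx))) _.
apply: aeW => t ye vw zv dy dv dz' lt_r.
have [i [ib ei]] := (heb (m t)).2 _ (Xw (m t) (n (m t) t)).
exists i; split=> //.
by rewrite (ye _ _ (dy i)) ei -(vw _ _ (dv _)) -(zv _ dz').
Qed.

(** * Greedy construction of separated points *)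

Section Separated.
Variable r : T -> R.
Hypothesis rpp : L0pp P r.

Fixpoint far (s : seq {x | S x}) x (t : T) : Prop :=
  if s is y :: s' then r t <= dm (sval y) x t /\ far s' x t else True.

Lemma far_congr s x y : S x -> S y ->
  \forall t \ae P, dm y x t = 0 -> far s x t -> far s y t.
Proof.
move=> Sx Sy; elim: s => [|[z Sz] s ih] /=; first exact: aeW.
apply: ae_mp ih _; apply: filterS (dist_congr_r Sz Sy Sx) => t e ih d0 [rz fs].
by split; [rewrite e|exact: ih].
Qed.

Lemma measurable_far s x : S x -> measurable [set t | far s x t].
Proof.
move=> Sx; elim: s => [|[z Sz] s ih] /=.
  by rewrite (_ : [set _ | _] = setT)//; apply/seteqP; split.
apply: (@measurableI _ _ [set t | r t <= dm z x t]) => //.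
rewrite -[X in measurable X]setTI.
have := measurable_fun_ler rpp.1 (dist_measurable Sz Sx).
by move=> /(_ measurableT [set true]); exact.
Qed.

(** Exhaustion over the sets on which some single point is r-far from [s]: witnesses on countably
    many such sets are glued along the least index. By maximality, off [xC.2] almost surely no given
    point is r-far. *)
Lemma farthest_point s : exists xC : {x | S x} * set T,
  [/\ measurable xC.2, \forall t \ae P, xC.2 t -> far s (sval xC.1) t &
    forall x, S x -> \forall t \ae P, far s x t -> xC.2 t].
Proof.
pose G A := measurable A /\ exists x, S x /\ \forall t \ae P, A t -> far s x t.
have [] := @maximal_ae_set _ _ _ P G.
- by have [[x Sx] _] := stS; exists set0; split=> //; exists x; split=> //; exact: aeW.
- by move=> A [].
- move=> A hA; have mA k := (hA k).1.
  split; first exact: bigcup_measurable.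
  have /choice[x hx] := fun k => (hA k).2.
  have Sx k := (hx k).1.
  have [y [Sy dy]] := glue (@subset_refl _ S) stS (Lsnat_least mA) Sx.
  exists y; split=> //; apply: ae_mp dy _.
  apply: ae_mp (ae_foralln (fun k => (hx k).2)) _.
  apply: filterS (ae_foralln (fun k => far_congr s (Sx k) Sy)) => t fc hf d0 [k _ Ak].
  by apply: fc d0 _; apply: hf; apply: (@least_index_mem _ _ A); exists k.
move=> C [[mC [x [Sx hx]]] maxC]; exists (exist _ x Sx, C); split=> //= y Sy.
apply: (maxC [set t | far s y t]); split; first exact: measurable_far.
by exists y; split=> //; exact: aeW.
Qed.

Lemma seq_compact_covers : stable_seq_compact S dm -> exists (y : nat -> M) p, covers r y p.
Proof.
move=> sc; have /choice[f hf] := farthest_point.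
(* [pre j] lists y_{j-1}, ..., y_0, and [f] extends it greedily. *)
pose fix pre j := if j is i.+1 then (f (pre i)).1 :: pre i else [::].
pose y j := sval (f (pre j)).1; pose C j := (f (pre j)).2.
have Sy j : S (y j) by exact: svalP.
have mC j : measurable (C j) by have [] := hf (pre j).
have farP j x t : far (pre j) x t <-> forall i, (i < j)%N -> r t <= dm (y i) x t.
  elim: j => [|j ih] /=; first by split.
  split=> [[rj /ih h] i|h].
    by rewrite ltnS leq_eqVlt => /orP[/eqP ->|]; [exact: rj|exact: h].
  by split; [exact: h|apply/ih => i /ltnW; exact: h].
(* On the intersection of all [C j] the points are r-separated, whereas two consecutive terms of a
   convergent subsequence, at [n] and n+1, both come within r/2 of the limit. *)
have exC : \forall t \ae P, exists j, (~` C j) t.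
  have [x [stx Sx dx]] := stable_seq_of Sy.
  have [nf [stnf [incnf [l [Sl xl]]]]] := sc x stx Sx.
  have r2 : L0pp P (fun t => 2^-1 * r t) by apply: L0pp_scale.
  have [n [mn hn]] := xl _ r2.
  pose n' t := (n t).+1.
  have mn' : Lsnat n'.
    by apply: (@Lsnat_comp2 _ _ (fun i _ => i.+1) n n).
  have ma := stnf.1 _ mn; have mb := stnf.1 _ mn'.
  apply: ae_mp (incnf n n' mn mn' (aeW _ (fun t => ltnSn _))) _.
  apply: ae_mp (hn n mn (aeW _ (fun t => leqnn _))) _.
  apply: ae_mp (hn n' mn' (aeW _ (fun t => leqnSn _))) _.
  apply: ae_mp (dx _ ma) _; apply: ae_mp (dx _ mb) _.
  apply: ae_mp (ae_foralln (fun i => dist_congr (Sx _ ma) (Sy i) Sl)) _.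
  apply: ae_mp (ae_foralln (fun i => dist_congr (Sx _ mb) (Sy i) Sl)) _.
  apply: ae_mp (ae_foralln (fun i => dist_sym (Sy i) Sl)) _.
  apply: ae_mp (ae_foralln (fun i => ae_foralln (fun j =>
    dist_triangle (Sy i) Sl (Sy j)))) _.
  have hC j : \forall t \ae P, C j t -> far (pre j) (y j) t by have [] := hf (pre j).
  apply: filterS (ae_foralln hC) => t fC tri sym cb ca db da lb la ab.
  apply: contrapT => nC.
  have /farP/(_ _ ab) : far (pre (nf n' t)) (y (nf n' t)) t.
    by apply: fC; apply: contrapT => nCt; apply: nC; exists (nf n' t).
  have := tri (nf n t) (nf n' t); rewrite -(sym (nf n' t)).
  by rewrite -(ca _ da) -(cb _ db); lra.
(* At the first j with t outside [C j], maximality of [C j] prevents x from being r-far from all of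
   y_0, ..., y_{j-1}. *)
exists y, (least_index (fun j => ~` C j)); split=> //.
  by apply: Lsnat_least => j; exact: measurableC.
move=> x Sx; have hC j : \forall t \ae P, far (pre j) x t -> C j t.
  by have [_ _] := hf (pre j); exact.
apply: ae_mp exC _; apply: filterS (ae_foralln hC) => t fC.
move=> /(@least_index_mem _ _ (fun j => ~` C j)) nC.
apply: contrapT => ni; apply: nC; apply: fC; apply/farP => i ip.
by rewrite leNgt; apply/negP => lt_r; apply: ni; exists i.
Qed.
End Separated.

Lemma seq_compact_totally_bounded_complete : stable_seq_compact S dm ->
  stable_totally_bounded S dm /\ stable_complete S dm.
Proof.
move=> sc; split; last exact: seq_compact_complete.
by apply: covers_totally_bounded => r rpp; exact: seq_compact_covers.
Qed.

(** * Cluster points of stable filter bases *)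

(** Bases are used instead of filters because cutting down to a ball is an operation on the base. *)
Definition stable_base (B : set (set M)) :=
  [/\ B !=set0, forall V, B V -> V `<=` S,
    forall U V, B U -> B V -> exists W, B W /\ W `<=` U `&` V &
    stable_collection B].

Section StableBase.
Variables (B : set (set M)) (r : T -> R).
Hypotheses (baseB : stable_base B) (rpp : L0pp P r).

Let BS V : B V -> V `<=` S.
Proof. by have [_ + _ _] := baseB; exact. Qed.

Let stB V : B V -> stable_set V.
Proof. by have [_ _ _ [+ _]] := baseB; exact. Qed.

Let sumB (A : nat -> set T) (V : nat -> set M) : mpartition A -> (forall k, B (V k)) ->
  B (sumset A V).
Proof. by have [_ _ _ [_ +]] := baseB; exact. Qed.

Lemma base_lower_bound (V : nat -> set M) (k : nat) : (forall i, B (V i)) ->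
  exists W, B W /\ forall i, (i < k)%N -> W `<=` V i.
Proof.
move=> BV; have [[V0 BV0] _ dirB _] := baseB.
elim: k => [|k [W [BW hW]]]; first by exists V0.
have [W' [BW' W'W]] := dirB _ _ BW (BV k); exists W'; split=> // i.
rewrite ltnS leq_eqVlt => /orP[/eqP ->|/hW WV] w /W'W[]//.
by move=> /WV.
Qed.

(** Two exhaustions: [C] is the largest set on which some member stays r-away from y, and, for a
    fixed V, [D] is the largest set on which some point of V comes within r of y. Off [D] all of V
    is r-away, so maximality of [C] puts the complement of [D] inside [C]. *)
Lemma base_dichotomy y : S y -> exists (C : set T) (W : set M),
  [/\ measurable C, B W,
    forall v, W v -> \forall t \ae P, C t -> r t <= dm y v t &
    forall V, B V -> exists v, V v /\
      \forall t \ae P, ~ C t -> dm y v t < r t].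
Proof.
move=> Sy.
pose G A := measurable A /\ exists W, B W /\
  forall v, W v -> \forall t \ae P, A t -> r t <= dm y v t.
have [] := @maximal_ae_set _ _ _ P G.
- have [[V0 BV0] _ _ _] := baseB; exists set0; split=> //; exists V0; split=> // v _.
  exact: aeW.
- by move=> A [].
- move=> A hA; have mA k := (hA k).1.
  split; first exact: bigcup_measurable.
  have /choice[W hW] := fun k => (hA k).2.
  have BW k := (hW k).1.
  have mn := Lsnat_least mA; have pn := Lsnat_mpartition mn.
  exists (sumset (level (least_index A)) W); split; first exact: sumB.
  move=> v /(sumset_dist _ pn (levelE _) (fun k => BS (BW k)))[Sv [w [Ww dv]]].
  have Sw k : S (w k) by exact: BS (BW k) _ (Ww k).
  apply: ae_mp dv _; apply: ae_mp (ae_foralln (fun k => (hW k).2 _ (Ww k))) _.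
  apply: filterS (ae_foralln (fun k => dist_congr_r Sy Sv (Sw k))).
  move=> t e h d0 [k _ Ak]; rewrite (e _ d0); apply: h.
  by apply: (@least_index_mem _ _ A); exists k.
move=> C [[mC [W [BW hW]]] maxC]; exists C, W; split=> // V BV.
have VS := BS BV; have stV := stB BV.
pose H A := measurable A /\ exists v, V v /\
  \forall t \ae P, A t -> dm y v t < r t.
have [] := @maximal_ae_set _ _ _ P H.
- have [[v Vv] _] := stV; exists set0; split=> //; exists v; split=> //.
  exact: aeW.
- by move=> A [].
- move=> A hA; have mA k := (hA k).1.
  split; first exact: bigcup_measurable.
  have /choice[v hv] := fun k => (hA k).2.
  have Vv k := (hv k).1; have Sv k := VS _ (Vv k).
  have [w [Vw dw]] := glue VS stV (Lsnat_least mA) Vv.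
  exists w; split=> //; apply: ae_mp dw _.
  apply: ae_mp (ae_foralln (fun k => (hv k).2)) _.
  apply: filterS (ae_foralln (fun k => dist_congr_r Sy (VS _ Vw) (Sv k))).
  move=> t e h d0 [k _ Ak]; rewrite (e _ d0); apply: h.
  by apply: (@least_index_mem _ _ A); exists k.
move=> D [[mD [v [Vv hv]]] maxD]; exists v; split=> //.
have DC : \forall t \ae P, (~` D) t -> C t.
  apply: maxC; split; first exact: measurableC.
  exists V; split=> // w Vw.
  have : \forall t \ae P, dm y w t < r t -> D t.
    apply: (maxD [set t | dm y w t < r t]); split.
      by apply: measurable_dist_lt => //; [exact: VS|exact: rpp.1].
    by exists w; split=> //; exact: aeW.
  by apply: filterS => t h nD; rewrite leNgt; apply/negP => /h.
apply: ae_mp hv _; apply: filterS DC => t DC hv nC; apply: hv.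
by apply: contrapT => /DC.
Qed.

Lemma base_center : (exists (y : nat -> M) p, covers r y p) ->
  exists z, S z /\ forall V, B V -> exists v, V v /\ sball S dm z r v.
Proof.
move=> [y [p [mp Sy cov]]].
have /choice[C /choice[W hCW]] := fun i => base_dichotomy (Sy i).
have mC i : measurable (C i) by have [] := hCW i.
have BW i : B (W i) by have [] := hCW i.
have WC i v : W i v -> \forall t \ae P, C i t -> r t <= dm (y i) v t.
  by have [_ _ + _] := hCW i; exact.
have CV i V : B V -> exists v, V v /\
    \forall t \ae P, ~ C i t -> dm (y i) v t < r t.
  by have [_ _ _] := hCW i; exact.
have pp := Lsnat_mpartition mp.
(* Where [p] equals k, use a member below W_0, ..., W_{k-1}, and concatenate these members along
   [p]. A point v of the result is within r of some centre i below [p], which contradicts the choice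
   of W_i on [C i]. *)
have nC : \forall t \ae P, exists i, (~` C i) t.
  have /choice[U hU] := fun k => base_lower_bound k BW.
  have BU k := (hU k).1.
  have [[v vU] _] := stB (sumB pp BU).
  have [Sv [w [Uw dv]]] :=
    (sumset_dist v pp (levelE p) (fun k => BS (BU k))).1 vU.
  have Sw k : S (w k) by exact: BS (BU k) _ (Uw k).
  have hw k i : \forall t \ae P, (i < k)%N -> C i t -> r t <= dm (y i) (w k) t.
    have [ik|ki] := ltnP i k; last exact: aeW.
    by apply: filterS (WC i _ ((hU k).2 i ik _ (Uw k))) => t h _.
  apply: ae_mp dv _; apply: ae_mp (cov v Sv) _.
  apply: ae_mp (ae_foralln (fun k => ae_foralln (hw k))) _.
  apply: filterS (ae_foralln (fun k => ae_foralln (fun i =>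
    dist_congr_r (Sy i) Sv (Sw k)))) => t e h [i [ip di]] d0.
  exists i => Ci; have := h _ _ ip Ci.
  by rewrite -(e _ _ d0) leNgt di.
(* The centre z equals y_i for the first i with t outside [C i], where every V contains points near
   y_i. *)
have mn : Lsnat (least_index (fun i => ~` C i)).
  by apply: Lsnat_least => i; exact: measurableC.
have [z [Sz dz]] := glue (@subset_refl _ S) stS mn Sy.
exists z; split=> // V BV.
have /choice[v hv] := fun i => CV i V BV.
have VS := BS BV; have Sv i := VS _ (hv i).1.
have [w [Vw dw]] := glue VS (stB BV) mn (fun i => (hv i).1).
have Sw := VS _ Vw.
exists w; split=> //; split=> //.
apply: ae_mp dz _; apply: ae_mp dw _; apply: ae_mp nC _.
apply: ae_mp (ae_foralln (fun i => (hv i).2)) _.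
apply: ae_mp (ae_foralln (fun i => dist_congr Sz (Sy i) Sw)) _.
apply: filterS (ae_foralln (fun i => ae_foralln (fun j =>
  dist_congr_r (Sy j) Sw (Sv i)))) => t ew ez h exn dw' dz'.
rewrite (ez _ dz') (ew _ _ dw'); apply: h.
exact: (@least_index_mem _ _ (fun i => ~` C i)).
Qed.

Lemma stable_base_restrict z : S z ->
  (forall V, B V -> exists v, V v /\ sball S dm z r v) ->
  stable_base [set W | exists V, B V /\ W = V `&` sball S dm z r].
Proof.
move=> Sz hz; have [[V0 BV0] _ dirB _] := baseB.
split.
- by exists (V0 `&` sball S dm z r), V0.
- by move=> _ [V [BV ->]] y [/(BS BV)].
- move=> _ _ [U [BU ->]] [V [BV ->]]; have [W [BW WUV]] := dirB _ _ BU BV.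
  exists (W `&` sball S dm z r); split; first by exists W.
  by move=> y [/WUV[Uy Vy] by_]; split; split.
split.
  move=> _ [V [BV ->]]; have VS := BS BV.
  apply: stable_setP => [y [/VS]//||n x y mn hx Sy dy].
    by have [v [Vv bv]] := hz V BV; exists v.
  have Vx k := (hx k).1; have Sx k := VS _ (Vx k).
  split; first exact: (glue_closed VS (stB BV) mn Vx Sy dy).
  split=> //; apply: ae_mp dy _; apply: ae_mp (ae_foralln (fun k => (hx k).2.2)) _.
  apply: filterS (ae_foralln (fun k => dist_congr_r Sz Sy (Sx k))) => t e h d0.
  by rewrite (e _ d0).
move=> A U pA /choice[V hV].
have BV k := (hV k).1; have VS k := BS (BV k).
have -> : U = fun k => V k `&` sball S dm z r.
  by apply/funext => k; exact: (hV k).2.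
have [m [mm Am]] := mpartition_index pA.
have US k : V k `&` sball S dm z r `<=` S by move=> y [/VS].
exists (sumset A V); split; first exact: sumB.
apply/seteqP; split=> y.
  move=> /(sumset_dist _ pA Am US)[Sy [w [Uw dy]]].
  have Sw k := US k _ (Uw k).
  split.
    by apply/(sumset_dist _ pA Am VS); split=> //; exists w; split=> // k; exact: (Uw k).1.
  split=> //; apply: ae_mp dy _; apply: ae_mp (ae_foralln (fun k => (Uw k).2.2)) _.
  apply: filterS (ae_foralln (fun k => dist_congr_r Sz Sy (Sw k))) => t e h d0.
  by rewrite (e _ d0).
move=> [/(sumset_dist _ pA Am VS)[Sy [w [Vw dy]]] [_ ry]].
have Sw k := VS k _ (Vw k).
apply/(sumset_dist _ pA Am US); split=> //.
(* [w k] is known to be in the ball only on [A k]; elsewhere it is replaced by a point [b k] of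
   [V k] inside the ball. *)
have /choice[b hb] := fun k => hz _ (BV k).
have Sb k := VS k _ (hb k).1.
have /choice[c hc] := fun k => glue2 (VS k) (stB (BV k)) (pA.1 k) (Vw k) (hb k).1.
have Sc k := VS k _ (hc k).1.
exists c; split=> [k|].
  split; first exact: (hc k).1.
  split=> //; apply: ae_mp (hc k).2 _; apply: ae_mp (hb k).2.2 _; apply: ae_mp ry _.
  apply: ae_mp dy _; apply: ae_mp (dist_congr_r Sz Sy (Sw k)) _.
  apply: ae_mp (dist_congr_r Sz (Sc k) (Sw k)) _.
  apply: filterS (dist_congr_r Sz (Sc k) (Sb k)).
  move=> t cb cw yw dy' ry' rb [hA hnA].
  have [Akt|nAkt] := pselect (A k t); last by rewrite (cb (hnA nAkt)).
  by move/Am: (Akt) => mk; rewrite (cw (hA Akt)) -yw// -mk.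
apply: ae_mp dy _; apply: ae_mp (ae_foralln (fun k => (hc k).2)) _.
apply: filterS (ae_foralln (fun k => dist_join0 Sy (Sc k) (Sw k))) => t h hct dy'.
by apply: h dy' _; apply: (hct _).1; apply/Am.
Qed.
End StableBase.

Section ClusterPoint.
Variable B : set (set M).
Hypotheses (baseB : stable_base B) (tb : stable_totally_bounded S dm)
  (cS : stable_complete S dm).

(* The j-th centre lies within 1/(j+1) of every member of the base cut down to
   the balls around the previous centres. *)
Lemma base_centers : exists z : nat -> M, [/\ forall j, S (z j),
  forall i j, \forall t \ae P, dm (z i) (z j) t <= i.+1%:R^-1 + j.+1%:R^-1 &
  forall V j, B V -> exists v, V v /\ sball S dm (z j) (fun=> j.+1%:R^-1) v].
Proof.
(* Being a base is a premise inside the choice, so [f] is total and the recursion for [Bs] can be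
   written before each stage is known to be a base. *)
have /choice[f hf] : forall jD : nat * set (set M), exists z, stable_base jD.2 ->
    S z /\ forall V, jD.2 V ->
      exists v, V v /\ sball S dm z (fun=> jD.1.+1%:R^-1) v.
  move=> [j D] /=; have [bD|nD] := pselect (stable_base D); last first.
    by have [[x _] _] := stS; exists x.
  have [z hz] := base_center bD (L0pp_inv j) (totally_bounded_covers tb (L0pp_inv j)).
  by exists z.
pose fix Bs j : set (set M) := if j is i.+1 then
  [set W | exists V, Bs i V /\ W = V `&` sball S dm (f (i, Bs i)) (fun=> i.+1%:R^-1)]
  else B.
pose z j := f (j, Bs j).
have baseBs j : stable_base (Bs j).
  elim: j => //= j ih; have [Sz hz] := hf (j, Bs j) ih.
  exact: stable_base_restrict.
have Sz j : S (z j) by have [] := hf (j, Bs j) (baseBs j).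
have hz j V : Bs j V -> exists v, V v /\ sball S dm (z j) (fun=> j.+1%:R^-1) v.
  by have [_] := hf (j, Bs j) (baseBs j); exact.
have sub V j : B V -> exists U, Bs j U /\ U `<=` V.
  move=> BV; elim: j => [|j [U [BU UV]]] /=; first by exists V; split.
  exists (U `&` sball S dm (z j) (fun=> j.+1%:R^-1)); split; first by exists U.
  by move=> y [/UV].
have balls j i U : (i < j)%N -> Bs j U -> U `<=` sball S dm (z i) (fun=> i.+1%:R^-1).
  elim: j U => // j ih U; rewrite ltnS leq_eqVlt => /orP[/eqP ->|ij] /= [V [BV ->]].
    exact: subIsetr.
  by move=> y [/(ih _ ij BV)].
exists z; split=> // [i j|V j BV]; last first.
  have [U [BU UV]] := sub V j BV; have [v [/UV Vv bv]] := hz j U BU.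
  by exists v.
(* Any member of stage max(i,j)+1 lies in both balls, and a point of it links the two centres. *)
have [[U BU] _ _ [st_ _]] := baseBs (maxn i j).+1.
have [[v Uv] _] := st_ U BU.
have lei : (i < (maxn i j).+1)%N by rewrite ltnS leq_maxl.
have lej : (j < (maxn i j).+1)%N by rewrite ltnS leq_maxr.
have [Sv vi] := balls _ _ _ lei BU v Uv; have [_ vj] := balls _ _ _ lej BU v Uv.
apply: ae_mp vi _; apply: ae_mp vj _; apply: ae_mp (dist_sym (Sz j) Sv) _.
apply: filterS (dist_triangle (Sz i) Sv (Sz j)) => t tri sym ltj lti.
by apply: le_trans tri _; rewrite -sym; apply: ltW; exact: ltrD.
Qed.

(** The centres are Cauchy, at rate 1/(i+1) + 1/(j+1), and every V comes within 1/(j+1) of the j-th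
    one, so V accumulates at their limit. *)
Lemma base_cluster : exists x, S x /\ forall V, B V -> forall r, L0pp P r ->
  exists y, V y /\ sball S dm x r y.
Proof.
have [_ BS _ [stB _]] := baseB.
have [z [Sz zz hz]] := base_centers.
have [x [stx Sx dx]] := stable_seq_of Sz.
have half r : L0pp P r -> L0pp P (fun t => 2^-1 * r t).
  by apply: L0pp_scale.
have [|l [Sl xl]] := cS stx Sx.
  move=> r /half/L0pp_index[n0 [mn0 hn0]]; exists n0; split=> // n m mn mm n0n n0m.
  apply: ae_mp hn0 _; apply: ae_mp n0n _; apply: ae_mp n0m _.
  apply: ae_mp (dx _ mn) _; apply: ae_mp (dx _ mm) _.
  apply: ae_mp (ae_foralln (fun i => dist_congr (Sx _ mn) (Sz i) (Sx _ mm))) _.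
  apply: ae_mp (ae_foralln (fun i => ae_foralln (fun j =>
    dist_congr_r (Sz i) (Sx _ mm) (Sz j)))) _.
  apply: filterS (ae_foralln (fun i => ae_foralln (zz i))) => t h em en dm' dn' lem len lt_r.
  rewrite (en _ dn') (em _ _ dm').
  have := h (n t) (m t); have := inv_le len; have := inv_le lem.
  move=> h1 h2 h3; apply: le_trans h3 _; apply: le_trans (lerD h2 h1) _.
  by move: lt_r; move: ((n0 t).+1%:R^-1) => e lt_r; lra.
exists l; split=> // V BV r /half r2.
have [n0 [mn0 hn0]] := L0pp_index r2; have [n1 [mn1 hn1]] := xl _ r2.
(* [n0] makes the radius 1/(n+1) smaller than r/2 and [n1] brings the centre within r/2 of l. The
   point w of V is glued along the same [n]. *)
pose n t := maxn (n0 t) (n1 t).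
have mn : Lsnat n by exact: Lsnat_comp2.
have /choice[v hv] := fun j => hz V j BV.
have VS := BS V BV; have Sv j := VS _ (hv j).1.
have [w [Vw dw]] := glue VS (stB V BV) mn (fun j => (hv j).1).
have Sw := VS _ Vw; exists w; split=> //; split=> //.
apply: ae_mp hn0 _; apply: ae_mp (hn1 n mn (aeW _ (fun t => leq_maxr _ _))) _.
apply: ae_mp dw _; apply: ae_mp (dx _ mn) _.
apply: ae_mp (ae_foralln (fun j => (hv j).2.2)) _.
apply: ae_mp (ae_foralln (fun j => dist_congr (Sx _ mn) (Sz j) Sl)) _.
apply: ae_mp (ae_foralln (fun j => dist_congr_r Sl Sw (Sv j))) _.
apply: ae_mp (ae_foralln (fun j => dist_sym (Sz j) Sl)) _.
apply: filterS (ae_foralln (fun j => dist_triangle Sl (Sz j) (Sv j))).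
move=> t tri sym ew ex hv' dx' dw' lt1 lt0.
rewrite (ew _ dw'); have := tri (n t); have := hv' (n t).
rewrite (ex _ dx') sym in lt1.
have /inv_le le0 : (n0 t <= n t)%N by exact: leq_maxl.
move=> h1 h2; apply: le_lt_trans h2 _.
by have := ltrD lt1 (lt_trans (lt_le_trans h1 le0) lt0); lra.
Qed.
End ClusterPoint.

Lemma totally_bounded_complete_compact :
  stable_totally_bounded S dm /\ stable_complete S dm -> stable_compact S dm.
Proof.
move=> [tb cS] F [[FS [F_S [F0 [FI FU]]]] [B [BF [baseF stB]]]].
have baseB : stable_base B.
  split=> //.
  - by have [V [BV _]] := baseF _ F_S; exists V.
  - by move=> V /BF/FS.
  - by move=> U V BU BV; exact: baseF (FI _ _ (BF _ BU) (BF _ BV)).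
have [x [Sx hx]] := base_cluster baseB tb cS.
exists x; split=> // U /baseF[V [BV VU]] r rpp.
by have [y [Vy ry]] := hx V BV r rpp; exists y; split=> //; exact: VU.
Qed.

End StableMetric.

Theorem theorem5 (d : measure_display) (T : measurableType d) (R : realType)
  (P : probability T R) (M : L0module P) (S : set M) (dm : M -> M -> T -> R) :
  stable_module M -> stable_set S -> stable_metric S dm ->
  [<-> stable_compact S dm;
       decreasing_closed_property S dm;
       stable_seq_compact S dm;
       stable_totally_bounded S dm /\ stable_complete S dm].
Proof.
move=> stM stS dS; tfae.
- exact: stable_compact_decreasing.
- exact: decreasing_closed_seq_compact.
- exact: seq_compact_totally_bounded_complete.
- exact: totally_bounded_complete_compact.
Qed.
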